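(* Let $\alpha>0$. The weight $v_\alpha$ is the optimal Hardy weight for $H_\alpha$, that is, the following assertions hold true: (i) The operator $H_\alpha-V_\alpha$ is nonnegative and the Hardy-type inequality $$\sum_{n\ge0}\big|\sqrt{n+\alpha+1}\,u_n-\sqrt{n+1}\,u_{n+1}\big|^2\ge\sum_{n\ge0}v_\alpha(n)|u_n|^2$$ holds true for all $u\in\ell^2_c(\mathbb{Z}_{\ge0})$. (ii) For any positive sequence $v=(v_n)_{n\ge0}$ such that $V\ne V_\alpha$ and $V\ge V_\alpha$, the operator $H_\alpha-V$ is not nonnegative in $\ell^2(\mathbb{Z}_{\ge0})$. (iii) For any $\lambda>0$ and any finite subset $X\subset\mathbb{Z}_{\ge0}$, the inequality $H_\alpha-V_\alpha\ge\lambda V_\alpha$ fails to hold on $\ell^2_c(\mathbb{Z}_{\ge0}\setminus X)$ (the inequality is understood in the form sense).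
   Context: For $\alpha>-1$ and a complex sequence $u=(u_n)_{n\ge 0}$ (with $u_{-1}:=0$) put $$(\tau_\alpha u)_n=-\sqrt{n(n+\alpha)}\,u_{n-1}+(2n+1+\alpha)u_n-\sqrt{(n+1)(n+1+\alpha)}\,u_{n+1},\quad n\ge 0.$$ The discrete Laguerre operator $H_\alpha$ in $\ell^2(\mathbb{Z}_{\ge 0})$ is $H_\alpha u=\tau_\alpha u$ with maximal domain $\{u\in\ell^2(\mathbb{Z}_{\ge0}) : \tau_\alpha u\in\ell^2(\mathbb{Z}_{\ge0})\}$; it is self-adjoint and nonnegative. For a real sequence $v=(v_n)_{n\ge0}$, $V$ denotes multiplication by $v$, $(Vu)_n=v_nu_n$, and $H_\alpha-V$ is the (self-adjoint) maximal operator $u\mapsto\tau_\alpha u-Vu$ on $\{u\in\ell^2(\mathbb{Z}_{\ge0}):\tau_\alpha u-Vu\in\ell^2(\mathbb{Z}_{\ge0})\}$. $V\ge V_\alpha$ means $v_n\ge v_\alpha(n)$ for all $n$. $\ell^2_c(Y)$ denotes the finitely supported sequences supported in $Y\subseteq\mathbb{Z}_{\ge0}$. For $\alpha>0$ the weight $v_\alpha=(v_\alpha(n))_{n\ge0}$ is $$v_\alpha(n)=\frac{q_\alpha(n)+q_\alpha(n+1)}{2},\qquad q_\alpha(n)=2n+\alpha-\sqrt{(2n+\alpha)^2-\alpha^2},\quad n\ge0,$$ and $V_\alpha$ is multiplication by $v_\alpha$. In (iii), ''$H_\alpha-V_\alpha\ge\lambda V_\alpha$ on $\ell^2_c(\mathbb{Z}_{\ge0}\setminus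 X)$ in the form sense'' means $\langle H_\alpha u,u\rangle_{\ell^2}-\sum_n v_\alpha(n)|u_n|^2\ge\lambda\sum_nv_\alpha(n)|u_n|^2$ for all $u\in\ell^2_c(\mathbb{Z}_{\ge0}\setminus X)$. *)

(* Defs.v *)
From Stdlib Require Import Reals List.
From Coquelicot Require Import Coquelicot.
Open Scope R_scope.

Definition cseq := nat -> C.

Definition ell2 (u : cseq) : Prop := ex_series (fun n => Cmod (u n) ^ 2).

Definition CSeries (a : nat -> C) : C :=
  (Series (fun n => Re (a n)), Series (fun n => Im (a n))).

(* Linear in the first argument; the series converges absolutely when both
   arguments are in [ell2]. *)
Definition inner (f g : cseq) : C := CSeries (fun n => (f n * Cconj (g n))%C).

Definition ell2c (Y : nat -> Prop) (u : cseq) : Prop :=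
  (exists N : nat, forall n : nat, (N <= n)%nat -> u n = RtoC 0) /\
  (forall n : nat, ~ Y n -> u n = RtoC 0).

(* A possibly unbounded operator in l^2; [act] is only meaningful on [dom]. *)
Record operator : Type := Operator {
  dom : cseq -> Prop;
  act : cseq -> cseq
}.

(* [0 <= <T u, u>] in C, i.e. the value is real and nonnegative. *)
Definition nonnegative (T : operator) : Prop :=
  forall u : cseq, dom T u ->
    Im (inner (act T u) u) = 0 /\ 0 <= Re (inner (act T u) u).

Definition maximal_operator (t : cseq -> cseq) : operator :=
  Operator (fun u => ell2 u /\ ell2 (t u)) t.

(* The value [u_(n-1)], with the convention [u_(-1) = 0]. *)
Definition prev (u : cseq) (n : nat) : C :=
  match n with O => RtoC 0 | S m => u m end.

Definition tau (alpha : R) (u : cseq) : cseq := fun n =>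
  (- (RtoC (sqrt (INR n * (INR n + alpha))) * prev u n)
   + RtoC (2 * INR n + 1 + alpha) * u n
   - RtoC (sqrt ((INR n + 1) * (INR n + 1 + alpha))) * u (S n))%C.

Definition mult (v : nat -> R) (u : cseq) : cseq := fun n => (RtoC (v n) * u n)%C.

Definition laguerre (alpha : R) : operator := maximal_operator (tau alpha).

Definition laguerre_minus (alpha : R) (v : nat -> R) : operator :=
  maximal_operator (fun u n => (tau alpha u n - mult v u n)%C).

Definition q_weight (alpha : R) (n : nat) : R :=
  2 * INR n + alpha - sqrt ((2 * INR n + alpha) ^ 2 - alpha ^ 2).

Definition v_weight (alpha : R) (n : nat) : R :=
  (q_weight alpha n + q_weight alpha (S n)) / 2.

(* [<H u, u> - sum v |u|^2 >= lambda * sum v |u|^2] for [u] in [ell2c Y].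
   [<H u, u>] is real for such [u], the operator being symmetric. *)
Definition form_bound (alpha lambda : R) (v : nat -> R) (Y : nat -> Prop) : Prop :=
  forall u : cseq, ell2c Y u ->
    Re (inner (act (laguerre alpha) u) u) - Series (fun n => v n * Cmod (u n) ^ 2)
    >= lambda * Series (fun n => v n * Cmod (u n) ^ 2).

(* Main.v *)
Require Import Defs.
From Stdlib Require Import Reals List.
From Coquelicot Require Import Coquelicot.
From Stdlib Require Import Arith Lra Lia Classical FunctionalExtensionality.
Open Scope R_scope.

(** The square root in [q_weight alpha n] equals [2 * sqrt (n * (n + alpha))].
    Writing [a n = sqrt (n * (n + alpha))], the weight is therefore
    [v n = 2 n + 1 + alpha - a n - a (n + 1)], so subtracting it from the
    Laguerre operator replaces the diagonal by the sum of the two neighbouring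
    off-diagonal weights. What remains is a weighted graph Laplacian on the
    half-line: its form on finitely supported sequences is the energy
    [sum (a (n + 1) * |u n - u (n + 1)|^2)] and the constant sequence is its
    ground state. The three assertions reflect three facts about this form.

    Nonnegativity is clear on finitely supported sequences, and the Hardy form
    differs from the Laguerre form only by a rearrangement
    ([sum_hardy_form]). For a general element [u] of the maximal domain,
    summation by parts leaves a boundary term bounded by
    [a (N + 1) * (2 * (|u N|^2 + |u (N + 1)|^2))] ([sum_tau_form],
    [sum_tau_form_Im]). Since the sum of the [1 / a n] diverges while [u] is
    square-summable, that bound cannot stay above a positive constant
    ([summable_not_ge_inverse_edge]), which is enough to determine the sign of
    the limit of the partial sums.

    Optimality of the potential is criticality of the energy form: again because
    the sum of the [1 / a n] diverges, the constant 1 is approximated by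
    finitely supported sequences of arbitrarily small energy
    ([logarithmic_cutoff]), and any extra potential at a single site makes the
    form negative on such a sequence.

    Optimality of the constant near infinity holds because the ground state is
    not in the weighted space: [v n] is of order [1 / n], so the sum of the
    [v n] diverges ([v_weight_log_scale]). Setting a cutoff to zero on an initial
    segment that contains the excluded set costs only one edge weight, a fixed
    amount of energy ([energy_truncated]), whereas its weighted mass is as large
    as desired.

    All divergences are measured by [log_scale], whose increments are at most
    [1 / a (n + 1)] and, up to a constant, at most [v n]; its telescoping sums
    stand in for the harmonic series. *)

(** * The energy form and the logarithmic scale *)

(** The weight of the edge from [n] to [n + 1] is the off-diagonal coefficient
    [a (n + 1)] with shifted index. As [a 0 = 0], the origin has no edge on its
    left and summation by parts leaves no boundary term there. *)
Definition edge (alpha : R) (n : nat) : R :=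
  sqrt ((INR n + 1) * (INR n + 1 + alpha)).

Definition energy (alpha : R) (u : cseq) (N : nat) : R :=
  sum_n (fun n => edge alpha n * Cmod (u n - u (S n))%C ^ 2) N.

Definition log_scale (alpha : R) (n : nat) : R := ln (INR n + 1 + alpha).

(** * Moduli, finite sums and finitely supported series *)

Lemma Cmod_sqr (z : C) : Cmod z ^ 2 = Re z ^ 2 + Im z ^ 2.
Proof.
  unfold Cmod, Re, Im. rewrite pow2_sqrt; [reflexivity|].
  pose proof (pow2_ge_0 (fst z)). pose proof (pow2_ge_0 (snd z)). lra.
Qed.

Lemma Cmod_RtoC_sqr (x : R) : Cmod (RtoC x) ^ 2 = x ^ 2.
Proof. rewrite Cmod_sqr; unfold RtoC; simpl; ring. Qed.

(** The equality is taken in [R]: in the generic form of this recursion it is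
    taken in the carrier of a monoid structure, where [ring] does not apply. *)
Lemma sum_n_succ (f : nat -> R) (N : nat) :
  sum_n f (S N) = sum_n f N + f (S N) :> R.
Proof. exact (sum_Sn f N). Qed.

Lemma sum_n_0 (f : nat -> R) : sum_n f 0 = f 0%nat :> R.
Proof. exact (sum_O f). Qed.

Lemma sum_n_nonneg (f : nat -> R) (N : nat) :
  (forall n, 0 <= f n) -> 0 <= sum_n f N.
Proof.
  intros Hf. induction N as [|N IH].
  - rewrite sum_n_0. apply Hf.
  - rewrite sum_n_succ. specialize (Hf (S N)). lra.
Qed.

Lemma sum_n_ge_term (f : nat -> R) (k N : nat) :
  (forall n, 0 <= f n) -> (k <= N)%nat -> f k <= sum_n f N.
Proof.
  intros Hf. induction N as [|N IH]; intros Hk.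
  - replace k with 0%nat by lia. rewrite sum_n_0. lra.
  - rewrite sum_n_succ. destruct (Nat.eq_dec k (S N)) as [->|Hne].
    + pose proof (sum_n_nonneg f N Hf). lra.
    + specialize (IH ltac:(lia)). specialize (Hf (S N)). lra.
Qed.

Lemma sum_n_ext_R (f g : nat -> R) (N : nat) :
  (forall n, f n = g n) -> sum_n f N = sum_n g N :> R.
Proof. exact (sum_n_ext f g N). Qed.

Lemma sum_n_minus_R (f g : nat -> R) (N : nat) :
  sum_n (fun n => f n - g n) N = sum_n f N - sum_n g N :> R.
Proof.
  induction N as [|N IH].
  - rewrite !sum_n_0. reflexivity.
  - rewrite !sum_n_succ, IH. ring.
Qed.

Lemma is_series_partial_sums (f : nat -> R) (l : R) :
  is_series f l <-> is_lim_seq (sum_n f) l.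
Proof. split; exact (fun H => H). Qed.

Lemma is_series_finite_support (f : nat -> R) (N : nat) :
  (forall n, (N < n)%nat -> f n = 0) -> is_series f (sum_n f N).
Proof.
  intros Hf. apply is_series_partial_sums.
  apply is_lim_seq_ext_loc with (fun _ => sum_n f N); [|apply is_lim_seq_const].
  exists N. intros n Hn. induction Hn as [|n Hn IH]; [reflexivity|].
  rewrite sum_n_succ, <- IH, Hf by lia. symmetry. apply Rplus_0_r.
Qed.

Lemma Series_finite_support (f : nat -> R) (N : nat) :
  (forall n, (N < n)%nat -> f n = 0) -> Series f = sum_n f N.
Proof. intros Hf. apply is_series_unique, is_series_finite_support, Hf. Qed.

(** * The weight and its comparison with the logarithm *)

(** The identity that makes the constant sequence a ground state: the diagonal
    left after subtracting the weight is the total weight of the edges at [n]. *)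
Lemma v_weight_edges (alpha : R) (n : nat) :
  0 < alpha ->
  v_weight alpha n =
    2 * INR n + 1 + alpha - sqrt (INR n * (INR n + alpha)) - edge alpha n.
Proof.
  intros Ha. pose proof (pos_INR n) as Hn.
  assert (Hq : forall x, 0 <= x ->
    sqrt ((2 * x + alpha) ^ 2 - alpha ^ 2) = 2 * sqrt (x * (x + alpha))).
  { intros x Hx.
    replace ((2 * x + alpha) ^ 2 - alpha ^ 2)
      with (2 ^ 2 * (x * (x + alpha))) by ring.
    rewrite sqrt_mult by nra. rewrite sqrt_pow2 by lra. reflexivity. }
  unfold v_weight, q_weight, edge.
  rewrite S_INR, !Hq by lra. lra.
Qed.

Lemma edge_nonneg (alpha : R) (n : nat) : 0 <= edge alpha n.
Proof. apply sqrt_pos. Qed.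

Lemma edge_le (alpha : R) (n : nat) :
  0 < alpha -> edge alpha n <= INR n + 1 + alpha.
Proof.
  intros Ha. pose proof (pos_INR n).
  rewrite <- (sqrt_pow2 (INR n + 1 + alpha)) by lra.
  apply sqrt_le_1; nra.
Qed.

Lemma log_scale_step (alpha : R) (n : nat) :
  0 < alpha ->
  0 <= log_scale alpha (S n) - log_scale alpha n <= / (INR n + 1 + alpha).
Proof.
  intros Ha. unfold log_scale. rewrite S_INR. pose proof (pos_INR n) as Hn.
  set (x := INR n + 1 + alpha). replace (INR n + 1 + 1 + alpha) with (x + 1)
    by (unfold x; ring).
  assert (Hx : 0 < x) by (unfold x; lra).
  split.
  - assert (ln x < ln (x + 1)) by (apply ln_increasing; lra). lra.
  - rewrite <- ln_div by lra.
    replace ((x + 1) / x) with (1 + / x) by (field; lra).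
    assert (Hi : 0 < / x) by (apply Rinv_0_lt_compat; lra).
    rewrite <- (ln_exp (/ x)) at 2.
    apply Rlt_le, ln_increasing; [lra|]. apply exp_ineq1; lra.
Qed.

(** A step of [log_scale] across an edge is at most the resistance
    [1 / edge alpha n] of that edge, and the total length is infinite. This is
    the recurrence of the half-line. *)
Lemma edge_log_scale_step (alpha : R) (n : nat) :
  0 < alpha ->
  edge alpha n * (log_scale alpha (S n) - log_scale alpha n) <= 1.
Proof.
  intros Ha. destruct (log_scale_step alpha n Ha) as [H0 H1].
  pose proof (edge_le alpha n Ha). pose proof (edge_nonneg alpha n).
  pose proof (pos_INR n).
  apply Rle_trans with ((INR n + 1 + alpha) * / (INR n + 1 + alpha)).
  - apply Rmult_le_compat; lra.
  - rewrite Rinv_r by lra. lra.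
Qed.

Lemma log_scale_increasing (alpha : R) (m n : nat) :
  0 < alpha -> (m <= n)%nat -> log_scale alpha m <= log_scale alpha n.
Proof.
  intros Ha Hmn. induction Hmn as [|n Hmn IH]; [lra|].
  pose proof (log_scale_step alpha n Ha). lra.
Qed.

Lemma log_scale_unbounded (alpha A : R) :
  0 < alpha -> exists N, forall n, (N <= n)%nat -> A <= log_scale alpha n.
Proof.
  intros Ha. destruct (nfloor_ex (exp A)) as [N [_ HN]].
  { apply Rlt_le, exp_pos. }
  exists N. intros n Hn.
  apply Rle_trans with (log_scale alpha N).
  - unfold log_scale. rewrite <- (ln_exp A).
    apply Rlt_le, ln_increasing; [apply exp_pos|lra].
  - now apply log_scale_increasing.
Qed.

(** Rationalising, [q_weight alpha n = alpha^2 / (2 n + alpha + 2 a n)], which is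
    at least [alpha^2 / (4 (n + 1 + alpha))] as [a n <= n + alpha / 2]. The
    average defining the weight keeps half of this even if the nonnegative term
    [q_weight alpha (n + 1)] is dropped. *)
Lemma v_weight_log_scale (alpha : R) (n : nat) :
  0 < alpha ->
  alpha ^ 2 / 8 * (log_scale alpha (S n) - log_scale alpha n)
  <= v_weight alpha n.
Proof.
  intros Ha. rewrite v_weight_edges by exact Ha.
  pose proof (log_scale_step alpha n Ha) as [_ Hstep].
  pose proof (pos_INR n) as Hn. unfold edge.
  (* With [s = sqrt (x * (x + alpha))],
     [(2 x + alpha - 2 s) * (2 x + alpha + 2 s) = alpha^2]. *)
  assert (Hq : forall x, 0 <= x ->
    0 <= 2 * x + alpha - 2 * sqrt (x * (x + alpha)) /\
    alpha ^ 2 <= (2 * x + alpha - 2 * sqrt (x * (x + alpha)))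
                  * (4 * (x + 1 + alpha))).
  { intros x Hx.
    assert (H0 : 0 <= x * (x + alpha)) by nra.
    pose proof (sqrt_pos (x * (x + alpha))) as Hs0.
    pose proof (sqrt_sqrt _ H0) as Hs. set (s := sqrt (x * (x + alpha))) in *.
    assert (s <= x + alpha / 2) by nra.
    split; nra. }
  destruct (Hq (INR n) Hn) as [_ H1].
  destruct (Hq (INR n + 1) ltac:(lra)) as [H2 _].
  apply Rle_trans with (alpha ^ 2 / 8 * / (INR n + 1 + alpha)).
  { apply Rmult_le_compat_l; [nra|exact Hstep]. }
  apply Rmult_le_reg_r with (INR n + 1 + alpha); [lra|].
  rewrite Rmult_assoc, Rinv_l by lra. nra.
Qed.

Lemma v_weight_nonneg (alpha : R) (n : nat) : 0 < alpha -> 0 <= v_weight alpha n.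
Proof.
  intros Ha. pose proof (v_weight_log_scale alpha n Ha).
  pose proof (log_scale_step alpha n Ha). nra.
Qed.

(** * Summation by parts *)

Lemma Re_minus_potential (z w : C) (x : R) :
  Re ((z - RtoC x * w) * Cconj w)%C = Re (z * Cconj w)%C - x * Cmod w ^ 2.
Proof. rewrite Cmod_sqr. destruct z, w. simpl. ring. Qed.

(** Here [energy alpha u N] includes the edge from [N] to [N + 1], which is why
    the boundary term pairs [u N - u (N + 1)] with [u (N + 1)] and vanishes as
    soon as [u (N + 1)] does. *)
Lemma sum_tau_form (alpha : R) (u : cseq) (N : nat) :
  0 < alpha ->
  sum_n (fun n => Re (tau alpha u n * Cconj (u n))%C) N
  = energy alpha u N + sum_n (fun n => v_weight alpha n * Cmod (u n) ^ 2) N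
    + edge alpha N * (Re (u N * Cconj (u (S N)))%C - Cmod (u (S N)) ^ 2) :> R.
Proof.
  intros Ha. unfold energy.
  induction N as [|N IH].
  - rewrite !sum_n_0, v_weight_edges, !Cmod_sqr by exact Ha. unfold tau, prev.
    rewrite Rmult_0_l, sqrt_0. fold (edge alpha 0).
    destruct (u 0%nat), (u 1%nat). simpl. ring.
  - rewrite !sum_n_succ, IH, v_weight_edges, !Cmod_sqr by exact Ha.
    unfold tau, prev. fold (edge alpha (S N)).
    rewrite !S_INR. fold (edge alpha N).
    destruct (u N), (u (S N)), (u (S (S N))). simpl. ring.
Qed.

(** The diagonal contributes real terms and the off-diagonal ones cancel in
    conjugate pairs, so only the current through the last edge survives. *)
Lemma sum_tau_form_Im (alpha : R) (u : cseq) (N : nat) :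
  sum_n (fun n => Im (tau alpha u n * Cconj (u n))%C) N
  = edge alpha N * Im (u N * Cconj (u (S N)))%C :> R.
Proof.
  induction N as [|N IH].
  - rewrite !sum_n_0. unfold tau, prev.
    rewrite Rmult_0_l, sqrt_0. fold (edge alpha 0).
    destruct (u 0%nat), (u 1%nat). simpl. ring.
  - rewrite !sum_n_succ, IH.
    unfold tau, prev. fold (edge alpha (S N)).
    rewrite !S_INR. fold (edge alpha N).
    destruct (u N), (u (S N)), (u (S (S N))). simpl. ring.
Qed.

(** Since [edge] is the product of the two square roots, both [|s u - t u'|^2]
    and [edge * |u - u'|^2] have the same cross term; the difference is diagonal
    and collects to the weight by [v_weight_edges]. *)
Lemma sum_hardy_form (alpha : R) (u : cseq) (N : nat) :
  0 < alpha ->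
  sum_n (fun n => Cmod (RtoC (sqrt (INR n + alpha + 1)) * u n
                        - RtoC (sqrt (INR n + 1)) * u (S n))%C ^ 2) N
  = energy alpha u N + sum_n (fun n => v_weight alpha n * Cmod (u n) ^ 2) N
    + (INR N + 1 - edge alpha N) * Cmod (u (S N)) ^ 2 :> R.
Proof.
  intros Ha. unfold energy.
  assert (Hterm : forall n,
    Cmod (RtoC (sqrt (INR n + alpha + 1)) * u n
          - RtoC (sqrt (INR n + 1)) * u (S n))%C ^ 2
    = edge alpha n * Cmod (u n - u (S n))%C ^ 2
      + (INR n + alpha + 1 - edge alpha n) * Cmod (u n) ^ 2
      + (INR n + 1 - edge alpha n) * Cmod (u (S n)) ^ 2).
  { intros n. pose proof (pos_INR n). unfold edge.
    rewrite sqrt_mult by lra.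
    replace (INR n + 1 + alpha) with (INR n + alpha + 1) by ring.
    pose proof (sqrt_sqrt (INR n + alpha + 1) ltac:(lra)) as H1.
    pose proof (sqrt_sqrt (INR n + 1) ltac:(lra)) as H2.
    set (s := sqrt (INR n + alpha + 1)) in *.
    set (t := sqrt (INR n + 1)) in *.
    rewrite <- H1, <- H2, !Cmod_sqr. destruct (u n), (u (S n)). simpl. ring. }
  induction N as [|N IH].
  - rewrite !sum_n_0, Hterm, v_weight_edges by exact Ha.
    simpl INR. rewrite Rmult_0_l, sqrt_0. ring.
  - rewrite !sum_n_succ, IH, Hterm, v_weight_edges, S_INR by exact Ha.
    fold (edge alpha N). ring.
Qed.

Lemma energy_nonneg (alpha : R) (u : cseq) (N : nat) : 0 <= energy alpha u N.
Proof.
  apply sum_n_nonneg. intros n.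
  apply Rmult_le_pos; [apply edge_nonneg|apply pow2_ge_0].
Qed.

(** * Nonnegativity on the maximal domain *)

(** If [w] dominated [c / edge] from some index on, it would dominate [c] times
    the increments of the unbounded [log_scale], and could not be summable. *)
Lemma summable_not_ge_inverse_edge (alpha c : R) (w : nat -> R) (N0 : nat) :
  0 < alpha -> 0 < c -> (forall n, 0 <= w n) -> ex_series w ->
  ~ (forall n, (N0 <= n)%nat -> c <= edge alpha n * w n).
Proof.
  intros Ha Hc Hw [l Hl] Hbig.
  assert (Hle : forall n, sum_n w n <= l).
  { intros n. apply is_lim_seq_incr_compare; [exact Hl|].
    intros k. rewrite sum_n_succ. specialize (Hw (S k)). lra. }
  assert (Hstep : forall n, (N0 <= n)%nat ->
    c * (log_scale alpha (S n) - log_scale alpha n) <= w n).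
  { intros n Hn. specialize (Hbig n Hn). specialize (Hw n).
    pose proof (edge_log_scale_step alpha n Ha).
    destruct (log_scale_step alpha n Ha) as [Hd _].
    set (d := log_scale alpha (S n) - log_scale alpha n) in *.
    apply Rle_trans with (edge alpha n * w n * d); [nra|].
    replace (edge alpha n * w n * d) with (edge alpha n * d * w n) by ring.
    nra. }
  assert (Hgrow : forall n, (N0 <= n)%nat ->
    c * (log_scale alpha (S n) - log_scale alpha N0) <= sum_n w n).
  { intros n Hn. induction Hn as [|n Hn IH].
    - pose proof (sum_n_ge_term w N0 N0 Hw (le_n _)).
      pose proof (Hstep N0 (le_n _)). lra.
    - rewrite sum_n_succ. pose proof (Hstep (S n) ltac:(lia)). nra. }
  destruct (log_scale_unbounded alpha (log_scale alpha N0 + (l + 1) / c) Ha)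
    as [N HN].
  specialize (HN (S (max N N0)) ltac:(lia)).
  specialize (Hgrow (max N N0) ltac:(lia)). specialize (Hle (max N N0)).
  assert (c * ((l + 1) / c) = l + 1) by (field; lra). nra.
Qed.

Lemma ex_series_shifted_sqr (u : cseq) :
  ell2 u -> ex_series (fun n => Cmod (u n) ^ 2 + Cmod (u (S n)) ^ 2).
Proof.
  intros Hu. apply (ex_series_plus (V := R_NormedModule)); [exact Hu|].
  exact (proj1 (ex_series_incr_1 (fun n => Cmod (u n) ^ 2)) Hu).
Qed.

Lemma product_conj_bound (z w : C) :
  Rabs (Re (z * Cconj w)%C) <= Cmod z ^ 2 + Cmod w ^ 2 /\
  Rabs (Im (z * Cconj w)%C) <= Cmod z ^ 2 + Cmod w ^ 2.
Proof.
  rewrite !Cmod_sqr. destruct z as [a b], w as [c d]. simpl.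
  pose proof (pow2_ge_0 (a + c)). pose proof (pow2_ge_0 (a - c)).
  pose proof (pow2_ge_0 (b + d)). pose proof (pow2_ge_0 (b - d)).
  pose proof (pow2_ge_0 (a + d)). pose proof (pow2_ge_0 (a - d)).
  pose proof (pow2_ge_0 (b + c)). pose proof (pow2_ge_0 (b - c)).
  split; apply Rabs_le; split; nra.
Qed.

Lemma inner_series (f g : cseq) :
  ell2 f -> ell2 g ->
  is_lim_seq (sum_n (fun n => Re (f n * Cconj (g n))%C)) (Re (inner f g)) /\
  is_lim_seq (sum_n (fun n => Im (f n * Cconj (g n))%C)) (Im (inner f g)).
Proof.
  intros Hf Hg.
  assert (Hfg : ex_series (fun n => Cmod (f n) ^ 2 + Cmod (g n) ^ 2)).
  { exact (ex_series_plus (V := R_NormedModule) _ _ Hf Hg). }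
  split; apply is_series_partial_sums, Series_correct;
    apply (ex_series_le (V := R_CompleteNormedModule)) with (2 := Hfg);
    intros n; apply product_conj_bound.
Qed.

(** The lower bound need not tend to zero, but by
    [summable_not_ge_inverse_edge] it comes arbitrarily close to zero at
    arbitrarily large indices, which suffices because [s] converges. *)
Lemma limit_nonneg_of_edge_bound (alpha : R) (s w : nat -> R) (l : R) :
  0 < alpha -> (forall n, 0 <= w n) -> ex_series w ->
  is_lim_seq s l -> (forall n, - (edge alpha n * w n) <= s n) -> 0 <= l.
Proof.
  intros Ha Hw Hex Hs Hbound.
  destruct (Rle_or_lt 0 l) as [Hl|Hl]; [exact Hl|exfalso].
  apply is_lim_seq_spec in Hs.
  destruct (Hs (mkposreal (- l / 2) ltac:(lra))) as [N0 HN0]. simpl in HN0.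
  apply (summable_not_ge_inverse_edge alpha (- l / 2) w N0 Ha ltac:(lra) Hw Hex).
  intros n Hn. specialize (HN0 n Hn). apply Rabs_def2 in HN0.
  specialize (Hbound n). lra.
Qed.

(** Both series are limits of their partial sums, which are the boundary terms
    plus, for the real part, a nonnegative energy. The vanishing of the
    imaginary part comes from applying the sign argument to it and to its
    opposite. *)
Lemma nonnegative_laguerre_minus_v_weight (alpha : R) :
  0 < alpha -> nonnegative (laguerre_minus alpha (v_weight alpha)).
Proof.
  intros Ha u [Hu HTu]. simpl in *.
  destruct (inner_series _ _ HTu Hu) as [HRe HIm].
  set (L := inner _ u) in *.
  set (w := fun n => 2 * (Cmod (u n) ^ 2 + Cmod (u (S n)) ^ 2)).
  assert (Hw : forall n, 0 <= w n).
  { intros n. unfold w. pose proof (pow2_ge_0 (Cmod (u n))).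
    pose proof (pow2_ge_0 (Cmod (u (S n)))). lra. }
  assert (Hex : ex_series w).
  { apply (ex_series_scal (V := R_NormedModule) 2).
    apply ex_series_shifted_sqr, Hu. }
  assert (Eim : forall N,
    sum_n (fun n => Im ((tau alpha u n - Defs.mult (v_weight alpha) u n)
                        * Cconj (u n))%C) N
    = edge alpha N * Im (u N * Cconj (u (S N)))%C :> R).
  { intros N. rewrite <- sum_tau_form_Im. apply sum_n_ext_R. intros n.
    unfold Defs.mult. destruct (tau alpha u n), (u n). simpl. ring. }
  assert (Bim : forall N, Rabs (edge alpha N * Im (u N * Cconj (u (S N)))%C)
                          <= edge alpha N * w N).
  { intros N. pose proof (edge_nonneg alpha N).
    rewrite Rabs_mult, (Rabs_right (edge _ _)) by lra.
    apply Rmult_le_compat_l; [lra|].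
    pose proof (proj2 (product_conj_bound (u N) (u (S N)))).
    specialize (Hw N). unfold w in *. lra. }
  split.
  - change (Im L = 0). apply Rle_antisym.
    + cut (0 <= - Im L); [lra|].
      apply is_lim_seq_opp in HIm.
      refine (limit_nonneg_of_edge_bound alpha _ w _ Ha Hw Hex HIm _).
      intros N. rewrite Eim. specialize (Bim N). apply Rabs_le_between in Bim.
      lra.
    + refine (limit_nonneg_of_edge_bound alpha _ w _ Ha Hw Hex HIm _).
      intros N. rewrite Eim. specialize (Bim N). apply Rabs_le_between in Bim.
      lra.
  - change (0 <= Re L).
    refine (limit_nonneg_of_edge_bound alpha _ w _ Ha Hw Hex HRe _).
    intros N.
    replace (sum_n _ N) with
      (energy alpha u N
       + edge alpha N * (Re (u N * Cconj (u (S N)))%C - Cmod (u (S N)) ^ 2)).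
    + pose proof (energy_nonneg alpha u N).
      pose proof (edge_nonneg alpha N) as He.
      pose proof (proj1 (product_conj_bound (u N) (u (S N)))) as HB.
      apply Rabs_le_between in HB.
      assert (edge alpha N * - w N
        <= edge alpha N * (Re (u N * Cconj (u (S N)))%C - Cmod (u (S N)) ^ 2)).
      { apply Rmult_le_compat_l; [exact He|]. unfold w.
        pose proof (pow2_ge_0 (Cmod (u N))). lra. }
      lra.
    + pose proof (sum_tau_form alpha u N Ha) as Hsum.
      transitivity
        (sum_n (fun n => Re (tau alpha u n * Cconj (u n))%C) N
         - sum_n (fun n => v_weight alpha n * Cmod (u n) ^ 2) N).
      { rewrite Hsum. ring. }
      rewrite <- sum_n_minus_R. apply sum_n_ext_R. intros n.
      symmetry. apply Re_minus_potential.
Qed.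

(** * Finitely supported sequences *)

Lemma hardy_inequality (alpha : R) (u : cseq) :
  0 < alpha -> ell2c (fun _ => True) u ->
  Series (fun n => Cmod (RtoC (sqrt (INR n + alpha + 1)) * u n
                         - RtoC (sqrt (INR n + 1)) * u (S n))%C ^ 2)
  >= Series (fun n => v_weight alpha n * Cmod (u n) ^ 2).
Proof.
  intros Ha [[N HN] _].
  rewrite !(Series_finite_support _ N).
  - rewrite sum_hardy_form, (HN (S N)), Cmod_0 by (exact Ha || lia).
    pose proof (energy_nonneg alpha u N). lra.
  - intros n Hn. rewrite HN, Cmod_0 by lia. ring.
  - intros n Hn. rewrite !HN by lia. rewrite Cmod_sqr. simpl. ring.
Qed.

Lemma finite_form (alpha : R) (v : nat -> R) (u : cseq) (N : nat) :
  0 < alpha -> (forall n, (N <= n)%nat -> u n = RtoC 0) ->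
  Re (inner (act (laguerre_minus alpha v) u) u)
  = energy alpha u N
    - sum_n (fun n => (v n - v_weight alpha n) * Cmod (u n) ^ 2) N.
Proof.
  intros Ha HN.
  change (Series (fun n => Re ((tau alpha u n - Defs.mult v u n)
                               * Cconj (u n))%C)
    = energy alpha u N
      - sum_n (fun n => (v n - v_weight alpha n) * Cmod (u n) ^ 2) N).
  rewrite (Series_finite_support _ N).
  2:{ intros n Hn. rewrite (HN n) by lia. simpl. ring. }
  pose proof (sum_tau_form alpha u N Ha) as Hsum.
  rewrite (HN (S N)), Cmod_0 in Hsum by lia.
  transitivity (sum_n (fun n => Re (tau alpha u n * Cconj (u n))%C) N
                - sum_n (fun n => v n * Cmod (u n) ^ 2) N).
  - rewrite <- sum_n_minus_R. apply sum_n_ext_R. intros n.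
    apply Re_minus_potential.
  - rewrite Hsum.
    replace (sum_n (fun n => (v n - v_weight alpha n) * Cmod (u n) ^ 2) N)
      with (sum_n (fun n => v n * Cmod (u n) ^ 2) N
            - sum_n (fun n => v_weight alpha n * Cmod (u n) ^ 2) N).
    + simpl. ring.
    + rewrite <- sum_n_minus_R. apply sum_n_ext_R. intros n. ring.
Qed.

(** The cutoff descends from 1 to 0 linearly in [log_scale] with slope [eps]. On
    each edge the weight times the drop is then at most [eps], so the energy is at
    most [eps] times the sum of the drops, which telescopes to at most 1. *)
Lemma logarithmic_cutoff (alpha eps : R) (M : nat) :
  0 < alpha -> 0 < eps ->
  exists (phi : nat -> R) (N : nat),
    (M <= N)%nat /\
    (forall n, (n <= M)%nat -> phi n = 1) /\
    (forall n, (N <= n)%nat -> phi n = 0) /\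
    (forall L, energy alpha (fun n => RtoC (phi n)) L <= eps).
Proof.
  intros Ha He. pose proof (log_scale_unbounded alpha) as Hunb.
  set (h := log_scale alpha).
  set (phi := fun n => Rmax 0 (Rmin 1 (1 - eps * (h n - h M)))).
  destruct (Hunb (h M + / eps) Ha) as [N HN].
  assert (Hmono : forall m n, (m <= n)%nat -> h m <= h n).
  { intros m n. now apply log_scale_increasing. }
  exists phi, (max M N). split; [lia|]. split; [|split].
  - intros n Hn. unfold phi. specialize (Hmono n M Hn).
    rewrite Rmin_left by nra. apply Rmax_right; lra.
  - intros n Hn. unfold phi. specialize (HN n ltac:(lia)). fold h in HN.
    assert (eps * / eps = 1) by (field; lra).
    rewrite Rmin_right by nra. apply Rmax_left; nra.
  - assert (Hstep : forall n,
      edge alpha n * Cmod (RtoC (phi n) - RtoC (phi (S n)))%C ^ 2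
      <= eps * (phi n - phi (S n))).
    { intros n. rewrite <- RtoC_minus, Cmod_RtoC_sqr.
      pose proof (edge_log_scale_step alpha n Ha) as He1.
      pose proof (edge_nonneg alpha n) as He0.
      specialize (Hmono n (S n) ltac:(lia)). fold h in He1.
      assert (Hd : 0 <= phi n - phi (S n) <= eps * (h (S n) - h n)).
      { unfold phi, Rmax, Rmin. repeat destruct (Rle_dec _ _); nra. }
      set (d := phi n - phi (S n)) in *.
      assert (edge alpha n * d <= eps) by nra.
      nra. }
    assert (Hphi : forall n, 0 <= phi n <= 1).
    { intros n. unfold phi, Rmax, Rmin. repeat destruct (Rle_dec _ _); lra. }
    intros L.
    apply Rle_trans with (eps * (phi 0%nat - phi (S L))).
    + unfold energy. induction L as [|L IH].
      * rewrite sum_n_0. apply Hstep.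
      * rewrite sum_n_succ. specialize (Hstep (S L)). lra.
    + pose proof (Hphi 0%nat). pose proof (Hphi (S L)). nra.
Qed.

Lemma ell2_finite_support (u : cseq) (N : nat) :
  (forall n, (N < n)%nat -> u n = RtoC 0) -> ell2 u.
Proof.
  intros HN. eexists. apply (is_series_finite_support _ N).
  intros n Hn. rewrite HN, Cmod_0 by lia. ring.
Qed.

(** * Optimality of the weight *)

(** A cutoff equal to 1 at a site where [v] exceeds the weight by [delta] loses at
    least [delta] there; taking its energy at most [delta / 2] makes the form
    negative. *)
Lemma larger_potential_not_nonnegative (alpha : R) (v : nat -> R) :
  0 < alpha -> v <> v_weight alpha -> (forall n, v n >= v_weight alpha n) ->
  ~ nonnegative (laguerre_minus alpha v).
Proof.
  intros Ha Hne Hge Hnn.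
  assert (Hk : exists k, v k <> v_weight alpha k).
  { apply not_all_ex_not. intros Heq. apply Hne.
    apply functional_extensionality, Heq. }
  destruct Hk as [k Hk].
  set (delta := v k - v_weight alpha k).
  assert (Hdelta : 0 < delta).
  { unfold delta. destruct (Hge k); lra. }
  destruct (logarithmic_cutoff alpha (delta / 2) k Ha ltac:(lra))
    as (phi & N & HkN & Hone & Hzero & Henergy).
  set (u := fun n => RtoC (phi n)).
  assert (Hu : forall n, (N <= n)%nat -> u n = RtoC 0).
  { intros n Hn. unfold u. now rewrite Hzero. }
  destruct (Hnn u) as [_ Hpos].
  { split; simpl.
    - apply (ell2_finite_support _ N). intros n Hn. apply Hu. lia.
    - apply (ell2_finite_support _ (S N)). intros n Hn.
      unfold tau, Defs.mult. destruct n as [|n]; [lia|]. simpl prev.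
      rewrite !Hu by lia. ring. }
  rewrite (finite_form alpha v u N Ha Hu) in Hpos.
  specialize (Henergy N). fold u in Henergy.
  assert (Hterm : delta <=
    sum_n (fun n => (v n - v_weight alpha n) * Cmod (u n) ^ 2) N).
  { replace delta with ((v k - v_weight alpha k) * Cmod (u k) ^ 2).
    - apply (sum_n_ge_term
        (fun n => (v n - v_weight alpha n) * Cmod (u n) ^ 2)); [|exact HkN].
      intros n. apply Rmult_le_pos; [specialize (Hge n); lra|apply pow2_ge_0].
    - unfold u. rewrite Cmod_RtoC_sqr, Hone by lia. unfold delta. ring. }
  lra.
Qed.

Lemma sum_v_weight_lower (alpha : R) (N : nat) :
  0 < alpha ->
  alpha ^ 2 / 8 * (log_scale alpha (S N) - log_scale alpha 0)
  <= sum_n (v_weight alpha) N.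
Proof.
  intros Ha. induction N as [|N IH].
  - rewrite sum_n_0. apply v_weight_log_scale, Ha.
  - rewrite sum_n_succ. pose proof (v_weight_log_scale alpha (S N) Ha). lra.
Qed.

Lemma list_bounded (X : list nat) : exists B, forall n, In n X -> (n <= B)%nat.
Proof.
  exists (list_max X). intros n Hn.
  pose proof (proj1 (list_max_le X (list_max X)) (le_n _)) as HF.
  rewrite Forall_forall in HF. now apply HF.
Qed.

Definition truncated (B : nat) (phi : nat -> R) (n : nat) : R :=
  if le_lt_dec n B then 0 else phi n.

(** Truncation removes the edges inside the segment and creates a single jump, of
    height 1, across the edge from [B] to [B + 1]. *)
Lemma energy_truncated (alpha : R) (B N : nat) (phi : nat -> R) :
  phi (S B) = 1 ->
  energy alpha (fun n => RtoC (truncated B phi n)) N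
  <= edge alpha B + energy alpha (fun n => RtoC (phi n)) N.
Proof.
  intros Hphi.
  assert (Hterm : forall (psi : nat -> R) n,
    edge alpha n * Cmod (RtoC (psi n) - RtoC (psi (S n)))%C ^ 2
    = edge alpha n * (psi n - psi (S n)) ^ 2).
  { intros psi n. now rewrite <- RtoC_minus, Cmod_RtoC_sqr. }
  assert (Hsq : forall n, 0 <= edge alpha n * (phi n - phi (S n)) ^ 2).
  { intros n. apply Rmult_le_pos; [apply edge_nonneg|apply pow2_ge_0]. }
  assert (Hstep : forall n,
    edge alpha n * (truncated B phi n - truncated B phi (S n)) ^ 2
    <= (if Nat.eq_dec n B then edge alpha B else 0)
       + edge alpha n * (phi n - phi (S n)) ^ 2).
  { intros n. specialize (Hsq n). unfold truncated.
    destruct (Nat.eq_dec n B) as [->|Hn].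
    - destruct (le_lt_dec B B); [|lia]. destruct (le_lt_dec (S B) B); [lia|].
      rewrite Hphi in *. lra.
    - destruct (le_lt_dec n B), (le_lt_dec (S n) B); try lia; lra. }
  pose proof (edge_nonneg alpha B) as HeB.
  unfold energy.
  enough (Hind : sum_n (fun n => edge alpha n *
      Cmod (RtoC (truncated B phi n) - RtoC (truncated B phi (S n)))%C ^ 2) N
    <= (if le_lt_dec B N then edge alpha B else 0)
       + sum_n (fun n => edge alpha n *
           Cmod (RtoC (phi n) - RtoC (phi (S n)))%C ^ 2) N).
  { destruct (le_lt_dec B N); lra. }
  induction N as [|N IH].
  - rewrite !sum_n_0, !Hterm. specialize (Hstep 0%nat).
    destruct (Nat.eq_dec 0 B), (le_lt_dec B 0); try lia; lra.
  - rewrite !sum_n_succ, !Hterm. specialize (Hstep (S N)).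
    destruct (Nat.eq_dec (S N) B), (le_lt_dec B (S N)), (le_lt_dec B N);
      try lia; lra.
Qed.

(** The test sequence is 0 up to a bound [B] of [X], equal to 1 from there to [M],
    and then cut off at energy cost 1. Its energy is at most [edge alpha B + 1]
    independently of [M], while its weighted mass exceeds
    [(edge alpha B + 1) / lambda] once [M] is large. *)
Lemma form_bound_fails (alpha lambda : R) (X : list nat) :
  0 < alpha -> 0 < lambda ->
  ~ form_bound alpha lambda (v_weight alpha) (fun n => ~ In n X).
Proof.
  intros Ha Hl Hfb. destruct (list_bounded X) as [B HB].
  (* The first summand compensates for the mass lost on the segment up to [B];
     the final 1 makes the inequality strict. *)
  set (A := sum_n (v_weight alpha) B + (edge alpha B + 1) / lambda + 1).
  destruct (log_scale_unbounded alpha (log_scale alpha 0 + A / (alpha ^ 2 / 8))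
              Ha) as [M0 HM0].
  set (M := max M0 (S B)).
  assert (HA : A <= sum_n (v_weight alpha) M).
  { apply Rle_trans with (2 := sum_v_weight_lower alpha M Ha).
    specialize (HM0 (S M) ltac:(lia)).
    assert (Hc : 0 < alpha ^ 2 / 8) by nra.
    replace A with (alpha ^ 2 / 8 * (A / (alpha ^ 2 / 8))) at 1 by (field; lra).
    apply Rmult_le_compat_l; lra. }
  destruct (logarithmic_cutoff alpha 1 M Ha ltac:(lra))
    as (phi & N & HMN & Hone & Hzero & Henergy).
  set (u := fun n => RtoC (truncated B phi n)).
  assert (Hu : forall n, (N <= n)%nat -> u n = RtoC 0).
  { intros n Hn. unfold u, truncated. rewrite Hzero by exact Hn.
    now destruct (le_lt_dec n B). }
  specialize (Hfb u).
  assert (Hsupp : ell2c (fun n => ~ In n X) u).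
  { split; [now exists N|]. intros n Hn. apply NNPP, HB in Hn.
    unfold u, truncated. now destruct (le_lt_dec n B); [|lia]. }
  specialize (Hfb Hsupp).
  pose proof (energy_truncated alpha B N phi (Hone (S B) ltac:(lia))) as HE.
  fold u in HE. specialize (Henergy N).
  assert (Hform : Re (inner (act (laguerre alpha) u) u)
    = energy alpha u N + sum_n (fun n => v_weight alpha n * Cmod (u n) ^ 2) N).
  { change (Series (fun n => Re (tau alpha u n * Cconj (u n))%C)
      = energy alpha u N
        + sum_n (fun n => v_weight alpha n * Cmod (u n) ^ 2) N).
    rewrite (Series_finite_support _ N).
    - pose proof (sum_tau_form alpha u N Ha) as Hsum.
      rewrite (Hu (S N)), Cmod_0 in Hsum by lia.
      rewrite Hsum. simpl. ring.
    - intros n Hn. rewrite (Hu n) by lia. simpl. ring. }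
  rewrite Hform in Hfb.
  rewrite (Series_finite_support (fun n => v_weight alpha n * Cmod (u n) ^ 2) N)
    in Hfb by (intros n Hn; rewrite Hu, Cmod_0 by lia; ring).
  assert (Hmass : forall m, (B <= m)%nat -> (m <= M)%nat ->
    sum_n (v_weight alpha) m - sum_n (v_weight alpha) B
    <= sum_n (fun n => v_weight alpha n * Cmod (u n) ^ 2) m).
  { intros m Hm. induction Hm as [|m Hm IH]; intros HmM.
    - rewrite Rminus_diag. apply sum_n_nonneg. intros n.
      apply Rmult_le_pos; [now apply v_weight_nonneg|apply pow2_ge_0].
    - rewrite !sum_n_succ. specialize (IH ltac:(lia)).
      replace (Cmod (u (S m)) ^ 2) with 1; [lra|].
      unfold u, truncated. rewrite Cmod_RtoC_sqr.
      destruct (le_lt_dec (S m) B); [lia|]. rewrite Hone by lia. ring. }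
  assert (Hmono : forall m, (M <= m)%nat ->
    sum_n (fun n => v_weight alpha n * Cmod (u n) ^ 2) M
    <= sum_n (fun n => v_weight alpha n * Cmod (u n) ^ 2) m).
  { intros m Hm. induction Hm as [|m Hm IH]; [lra|].
    rewrite sum_n_succ.
    assert (0 <= v_weight alpha (S m) * Cmod (u (S m)) ^ 2).
    { apply Rmult_le_pos; [now apply v_weight_nonneg|apply pow2_ge_0]. }
    lra. }
  specialize (Hmass M ltac:(lia) (le_n _)). specialize (Hmono N HMN).
  set (mass := sum_n (fun n => v_weight alpha n * Cmod (u n) ^ 2) N) in *.
  assert (Hlow : (edge alpha B + 1) / lambda + 1 <= mass) by (unfold A in HA; lra).
  assert (lambda * ((edge alpha B + 1) / lambda) = edge alpha B + 1)
    by (field; lra).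
  nra.
Qed.

Theorem theorem5p8 (alpha : R) (halpha : 0 < alpha) :
  (nonnegative (laguerre_minus alpha (v_weight alpha)) /\
   forall u : cseq, ell2c (fun _ => True) u ->
     Series (fun n => Cmod (RtoC (sqrt (INR n + alpha + 1)) * u n
                            - RtoC (sqrt (INR n + 1)) * u (S n))%C ^ 2)
     >= Series (fun n => v_weight alpha n * Cmod (u n) ^ 2)) /\
  (forall v : nat -> R,
     (forall n : nat, 0 < v n) ->
     v <> v_weight alpha ->
     (forall n : nat, v n >= v_weight alpha n) ->
     ~ nonnegative (laguerre_minus alpha v)) /\
  (forall lambda : R, 0 < lambda ->
   forall X : list nat,
     ~ form_bound alpha lambda (v_weight alpha) (fun n => ~ In n X)).
Proof.
  split; [split|split].
  - now apply nonnegative_laguerre_minus_v_weight.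
  - intros u Hu. now apply hardy_inequality.
  - intros v _ Hne Hge. now apply larger_potential_not_nonnegative.
  - intros lambda Hl X. now apply form_bound_fails.
Qed.
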